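(* Let $N=\{\sum_{i=0}^5x_i=\sum_{i=0}^5\frac1{x_i}=0\}\subset\mathbb P_5$ be the Barth-Nieto quintic, and let $V$ be the threefold given in inhomogeneous coordinates $x,y,z,t$ by $$(1+x+xy+xyz)(1+z+yz+xyz)=\frac{(t+1)^2}{t}\,xyz .$$ There exists a birational equivalence between $N$ and $V$ which is defined over $\mathbb Q$.
   Context: The equation $\sum 1/x_i=0$ is understood after clearing denominators: $N$ is the irreducible quintic hypersurface $\sum_{j=0}^5\prod_{i\ne j}x_i=0$ in $\{\sum_{i=0}^5x_i=0\}\cong\mathbb P_4$. (Verrill's Calabi-Yau threefold $\mathcal Z_{A_3}$ is a smooth model of $V$, and $N$ has the smooth Calabi-Yau model $Y$ of Barth and Nieto, so this is equivalently a birational equivalence over $\mathbb Q$ between $Y$ and $\mathcal Z_{A_3}$.) *)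

(* Defs.v *)
From mathcomp Require Import all_boot all_order all_algebra.
From mathcomp Require Import mpoly.

Set Implicit Arguments.
Unset Strict Implicit.
Unset Printing Implicit Defensive.

Import GRing.Theory Num.Theory.
Local Open Scope ring_scope.

(* A point of P_n(K) is represented by a nonzero vector of homogeneous
   coordinates, and a subset of P_n(K) by a predicate on vectors that is stable
   under scaling by nonzero constants and excludes the zero vector. *)
Definition hvec (K : Type) (n : nat) : Type := 'I_n.+1 -> K.

Definition pset (K : Type) (n : nat) : Type := hvec K n -> Prop.

Definition same_point (K : fieldType) (n : nat) (u v : hvec K n) : Prop :=
  exists2 c : K, c != 0 & forall i, v i = c * u i.

(* Equations and open sets are geometric: coefficients in K. *)
Definition homogeneous_family (K : fieldType) (n : nat)
    (S : {mpoly K[n.+1]} -> Prop) : Prop :=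
  forall p, S p -> exists d : nat, p \is d.-homog.

Definition zeros (K : fieldType) (n : nat)
    (S : {mpoly K[n.+1]} -> Prop) : pset K n :=
  fun v => forall p, S p -> p.@[v] = 0.

Definition zariski_open_in (K : fieldType) (n : nat) (X U : pset K n) : Prop :=
  exists2 S : {mpoly K[n.+1]} -> Prop, homogeneous_family S &
    forall v, U v <-> X v /\ ~ zeros S v.

Definition zariski_dense_in (K : fieldType) (n : nat) (X U : pset K n) : Prop :=
  forall S : {mpoly K[n.+1]} -> Prop, homogeneous_family S ->
    (forall v, U v -> zeros S v) -> forall v, X v -> zeros S v.

(* Opens are required to be dense rather than nonempty, so that no
   irreducibility is presupposed. *)
Definition generically (K : fieldType) (n : nat) (X P : pset K n) : Prop :=
  exists U : pset K n,
    [/\ zariski_open_in X U, zariski_dense_in X U & forall v, U v -> P v].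

(* A rational map from an irreducible subset of P_n to P_m, defined over Q, is
   given by m+1 forms of one common degree with rational coefficients. *)
Record forms_overQ (n m : nat) := FormsOverQ {
  forms_deg : nat;
  forms_of :> 'I_m.+1 -> {mpoly rat[n.+1]};
  forms_homog : forall j, forms_of j \is forms_deg.-homog }.

Definition eval_forms (K : numFieldType) (n m : nat) (F : forms_overQ n m)
    (v : hvec K n) : hvec K m :=
  fun j => (map_mpoly (@ratr K) (F j)).@[v].

(* As Y excludes the zero vector, F is in particular regular, as written, on a
   dense open subset of X. *)
Definition rational_map (K : numFieldType) (n m : nat)
    (X : pset K n) (Y : pset K m) (F : forms_overQ n m) : Prop :=
  generically X (fun v => Y (eval_forms F v)).

Definition birational_overQ (K : numFieldType) (n m : nat)
    (X : pset K n) (Y : pset K m) : Prop :=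
  exists (F : forms_overQ n m) (G : forms_overQ m n),
    [/\ rational_map X Y F,
        rational_map Y X G,
        generically X (fun v => same_point v (eval_forms G (eval_forms F v))) &
        generically Y (fun w => same_point w (eval_forms F (eval_forms G w)))].

Definition barth_nieto (K : fieldType) : pset K 5 := fun x =>
  [/\ exists i, x i != 0,
      \sum_(i < 6) x i = 0 &
      \sum_(j < 6) \prod_(i < 6 | i != j) x i = 0].

Definition V_affine (K : fieldType) (x y z t : K) : Prop :=
  t != 0 /\
  (1 + x + x * y + x * y * z) * (1 + z + y * z + x * y * z) =
    (t + 1) ^+ 2 / t * (x * y * z).

(* The affine threefold, placed in P_4 by (x, y, z, t) |-> (1 : x : y : z : t);
   its closure in any compactification has the same rational maps. *)
Definition V_threefold (K : fieldType) : pset K 4 := fun v =>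
  exists x y z t : K,
    V_affine x y z t /\ same_point (tnth [tuple 1; x; y; z; t]) v.

(* Main.v *)
Require Import Defs.
From mathcomp Require Import all_boot all_order all_algebra.
From mathcomp Require Import perm mpoly ring.

Set Implicit Arguments.
Unset Strict Implicit.
Unset Printing Implicit Defensive.

Import GRing.Theory Num.Theory.
Local Open Scope ring_scope.

(** Put X0, X1, X2, X3 = 1, x, xy, xyz.  Then the equation of V reads
    (X0 + X1 + X2 + X3) (1/X0 + 1/X1 + 1/X2 + 1/X3) = (t+1)^2 / t,
    while on N one has x0 + x1 + x2 + x3 = - (x4 + x5) and
    1/x0 + ... + 1/x3 = - (x4 + x5) / (x4 x5), so that
    (x0 + ... + x3) (1/x0 + ... + 1/x3) = (x4 + x5)^2 / (x4 x5).
    Hence x = x1/x0, y = x2/x1, z = x3/x2, t = x4/x5 maps N to V.  Conversely,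
    with s = X0 + ... + X3, the point
    (X0 : X1 : X2 : X3 : - s t/(t+1) : - s/(t+1)) lies on N.  Cleared of
    denominators these are the quartic forms [N_to_V] and [V_to_N]; they are
    mutually inverse wherever x0 x1 x2 x3 x4 x5 (x4 + x5) <> 0 on N and
    x y z (t + 1) <> 0 on V ([N_to_V_in_V], [V_to_N_in_N], [N_to_VK],
    [V_to_NK]).

    What remains is that these open sets are dense in all of N and V, boundary
    points included ([N_open_dense], [V_open_dense]).  Irreducibility is not
    used.  Instead every boundary point is put on a curve whose other points,
    up to finitely many parameters, lie in the open set or are of a kind
    treated before.  Both threefolds are
    double covers in many ways: the curves are given by a parameter e and a
    root T of a quadratic alpha(e) T^2 + beta(e) T + gamma(e) with
    alpha(0) <> 0.  A polynomial p vanishing at both roots for almost all e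
    vanishes at the roots for e = 0, since the trace and the norm of p modulo
    the quadratic vanish identically in e ([closure_quadratic]).

    On N, the quadratic is satisfied by two of the coordinates, when the
    other four move on a line and the sum of all six is 0; its leading
    coefficient is the third elementary symmetric function of those four
    ([N_closure_pair]).  The only points where no pair of coordinates serves
    are (0 : 0 : 0 : 0 : 1 : -1) and its permutations.  These lie on the
    rational curve (e : -e : 2e : -2e : 1 : -1), or a permutation of it, whose
    points with e <> 0 have no zero coordinate, hence are already treated
    ([N_torus_closure]).

    On V, the quadratic in t serves where x y z <> 0 ([V_torus_closure]).  A
    quadratic in 1/x or 1/z serves wherever x y z = 0 ([V_closure_x],
    [V_closure_z]), except at (x, y, z) = (-1, 0, -1), which needs curves of
    its own ([V_closure_y0]). *)

(** * Zariski closure and density *)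

(** The Zariski closure of the cone U, tested on all polynomials; testing on
    inhomogeneous polynomials only makes membership stronger. *)
Definition in_closure (K : fieldType) (n : nat) (U : pset K n) (v : hvec K n) :=
  forall p : {mpoly K[n.+1]}, (forall u, U u -> p.@[u] = 0) -> p.@[v] = 0.

Lemma closure_self (K : fieldType) n (U : pset K n) v :
  U v -> in_closure U v.
Proof. by move=> Uv p; apply. Qed.

Lemma closure_trans (K : fieldType) n (U W : pset K n) v :
  (forall u, W u -> in_closure U u) -> in_closure W v -> in_closure U v.
Proof. by move=> sWU Wv p p0; apply: Wv => u /sWU; apply. Qed.

Lemma closure_eq (K : fieldType) n (U : pset K n) u v :
  u =1 v -> in_closure U u -> in_closure U v.
Proof. by move=> uv Uu p /Uu <-; apply: meval_eq => i; rewrite uv. Qed.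

Lemma closure_perm (K : fieldType) n (U : pset K n) (s : 'S_n.+1) v :
  (forall u, U u -> U (u \o s)) -> in_closure U v -> in_closure U (v \o s).
Proof.
move=> sU Uv p p0.
have E u : (p \mPo [tuple 'X_(s i) | i < n.+1]).@[u] = p.@[u \o s].
  by rewrite comp_mpoly_meval; apply: meval_eq => i; rewrite tnth_mktuple mevalXU.
by rewrite -E; apply: Uv => u /sU /p0; rewrite E.
Qed.

Lemma closure_dense (K : fieldType) n (X U : pset K n) :
  (forall v, X v -> in_closure U v) -> zariski_dense_in X U.
Proof. by move=> cl S _ US v /cl clv p Sp; apply: clv => u /US; apply. Qed.

(** The open sets needed are complements of a single hypersurface. *)
Lemma generically_nonzero (K : fieldType) n (X P : pset K n) d p :
  p \is d.-homog ->
  (forall v, X v -> in_closure (fun u => X u /\ p.@[u] != 0) v) ->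
  (forall v, X v -> p.@[v] != 0 -> P v) -> generically X P.
Proof.
move=> hp cl XP; exists (fun u => X u /\ p.@[u] != 0); split.
- exists (eq^~ p) => [_ ->|v]; first by exists d.
  split=> -[Xv pv]; split=> //; first by move=> /(_ p erefl) /eqP; apply/negP.
  by apply/eqP => pv0; apply: pv => _ ->.
- exact: closure_dense.
- by move=> v [] /XP; apply.
Qed.

(** * Curves given by a quadratic equation *)

(** Functions of two variables that are given by a polynomial: T is substituted
    for the outer variable and e for the inner one. *)
Definition bipoly (K : fieldType) (g : K -> K -> K) :=
  exists q : {poly {poly K}}, forall e T, g e T = q.[T%:P].[e].

Lemma bipoly_cst (K : fieldType) (c : K) : bipoly (fun _ _ : K => c).
Proof. by exists c%:P%:P => e T; rewrite !hornerC. Qed.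

Lemma bipoly_fst (K : fieldType) : bipoly (fun e _ : K => e).
Proof. by exists ('X%:P) => e T; rewrite hornerC hornerX. Qed.

Lemma bipoly_snd (K : fieldType) : bipoly (fun _ T : K => T).
Proof. by exists 'X => e T; rewrite hornerX hornerC. Qed.

Lemma bipolyD (K : fieldType) (g h : K -> K -> K) :
  bipoly g -> bipoly h -> bipoly (fun e T => g e T + h e T).
Proof. by move=> [p gp] [q hq]; exists (p + q) => e T; rewrite gp hq !hornerD. Qed.

Lemma bipolyN (K : fieldType) (g : K -> K -> K) : bipoly g -> bipoly (fun e T => - g e T).
Proof. by move=> [p gp]; exists (- p) => e T; rewrite gp !hornerN. Qed.

Lemma bipolyM (K : fieldType) (g h : K -> K -> K) :
  bipoly g -> bipoly h -> bipoly (fun e T => g e T * h e T).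
Proof. by move=> [p gp] [q hq]; exists (p * q) => e T; rewrite gp hq !hornerM. Qed.

Lemma bipolyX (K : fieldType) (g : K -> K -> K) k : bipoly g -> bipoly (fun e T => g e T ^+ k).
Proof. by move=> [p gp]; exists (p ^+ k) => e T; rewrite gp !horner_exp. Qed.

Lemma bipoly_meval (K : fieldType) n (p : {mpoly K[n.+1]}) (v : K -> K -> hvec K n) :
  (forall i, bipoly (fun e T => v e T i)) -> bipoly (fun e T => p.@[v e T]).
Proof.
move=> /fin_all_exists [q hq].
exists (\sum_(m <- msupp p) (p@_m)%:P%:P * \prod_i q i ^+ m i) => e T.
rewrite mevalE !horner_sum; apply: eq_bigr => m _.
rewrite !hornerM !hornerC !horner_prod; congr (_ * _).
by apply: eq_bigr => i _; rewrite !horner_exp hq.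
Qed.

(** Pseudo-division of a polynomial in T by a quadratic: on its roots g is
    affine in T, up to a power of the leading coefficient. *)
Lemma bipoly_mod_quadratic (K : fieldType) (g : K -> K -> K) (A B C : {poly K}) : bipoly g ->
  exists k (p0 p1 : {poly K}), forall e T,
    A.[e] * T ^+ 2 + B.[e] * T + C.[e] = 0 ->
    A.[e] ^+ k * g e T = p0.[e] + p1.[e] * T.
Proof.
move=> [q hq].
suff [k [p0 [p1 hp]]] : exists k (p0 p1 : {poly K}), forall e T,
    A.[e] * T ^+ 2 + B.[e] * T + C.[e] = 0 ->
    A.[e] ^+ k * q.[T%:P].[e] = p0.[e] + p1.[e] * T.
  by exists k, p0, p1 => e T; rewrite hq; apply: hp.
elim/poly_ind: q {g hq} => [|q c [k [p0 [p1 IH]]]].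
  by exists 0%N, 0, 0 => e T _; rewrite !horner0; ring.
exists k.+1, (A ^+ k.+1 * c - p1 * C), (A * p0 - p1 * B) => e T eq0.
have {IH} := IH e T eq0; rewrite !hornerE => IH.
rewrite exprS mulrDr mulrA -(mulrA A.[e]) IH.
transitivity (p1.[e] * (A.[e] * T ^+ 2 + B.[e] * T + C.[e]) +
  (A.[e] ^+ k.+1 * c.[e] - p1.[e] * C.[e] + (A.[e] * p0.[e] - p1.[e] * B.[e]) * T)).
  by rewrite (exprS _ k); ring.
by rewrite eq0 mulr0 add0r exprS.
Qed.

Lemma poly_eq0_of_horner (K : numFieldType) (p : {poly K}) :
  (forall x, p.[x] = 0) -> p = 0.
Proof.
move=> p0; apply/eqP/negPn/negP => /max_poly_roots.
move=> /(_ [seq i%:R | i <- iota 0 (size p)]); rewrite size_map size_iota ltnn => H.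
suff : false by []. apply: H; first by apply/allP => _ /mapP[i _ ->]; apply/eqP.
by rewrite map_inj_uniq ?iota_uniq // => i j /eqP; rewrite eqr_nat => /eqP.
Qed.

Lemma poly_dense_eq0 (K : numFieldType) (b g : {poly K}) :
  b != 0 -> (forall e, b.[e] != 0 -> g.[e] = 0) -> g = 0.
Proof.
move=> b0 bg; apply/eqP; suff: b * g == 0 by rewrite mulf_eq0 (negbTE b0).
apply/eqP/poly_eq0_of_horner => e; rewrite hornerM.
by have [->|/bg ->] := eqVneq b.[e] 0; rewrite (mul0r, mulr0).
Qed.

(** The point with parameters (0, T0) of the curve
    alpha(e) T^2 + beta(e) T + gamma(e) = 0 is in the closure of the points
    with b(e) <> 0.  The root T0 need not be simple, and the quadratic may be
    reducible or a square. *)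
Lemma closure_quadratic (K : numClosedFieldType) n (U : pset K n)
    (alpha beta gamma b : K -> K) (v : K -> K -> hvec K n) (T0 : K) :
  bipoly (fun e _ => alpha e) -> bipoly (fun e _ => beta e) ->
  bipoly (fun e _ => gamma e) -> bipoly (fun e _ => b e) ->
  (forall i, bipoly (fun e T => v e T i)) ->
  alpha 0 != 0 -> b 1 != 0 ->
  alpha 0 * T0 ^+ 2 + beta 0 * T0 + gamma 0 = 0 ->
  (forall e T, b e != 0 -> alpha e * T ^+ 2 + beta e * T + gamma e = 0 ->
     U (v e T)) ->
  in_closure U (v 0 T0).
Proof.
have fstP g : bipoly (fun e _ => g e) -> exists p : {poly K}, g =1 horner p.
  by move=> [q hq]; exists q.[0] => e; rewrite (hq e 0) polyC0.
move=> /fstP[A hA] /fstP[B hB] /fstP[C hC] /fstP[b' hb] vP.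
rewrite hA hB hC hb => A0 b1 eq0 UP p pU.
have [k [p0 [p1 hp]]] := bipoly_mod_quadratic A B C (bipoly_meval p vP).
have bA0 : b' * A != 0.
  by rewrite mulf_neq0 //; [apply: contraNneq b1|apply: contraNneq A0] => ->;
     rewrite horner0.
(* The trace (times A) and the norm (times A) of p0 + p1 T vanish. *)
have van e : (b' * A).[e] != 0 ->
    2 * A.[e] * p0.[e] - B.[e] * p1.[e] = 0 /\
    A.[e] * p0.[e] ^+ 2 - B.[e] * p0.[e] * p1.[e] + C.[e] * p1.[e] ^+ 2 = 0.
  rewrite hornerM mulf_eq0 negb_or => /andP[be Ae].
  have [r hr] : exists r, A.[e] * r ^+ 2 + B.[e] * r + C.[e] = 0.
    have [r hr] := @solve_monicpoly K 2 (nth 0 [:: - C.[e] / A.[e]; - B.[e] / A.[e]]) isT.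
    exists r; rewrite hr !big_ord_recl big_ord0 /=; field.
    by rewrite Ae.
  have rt T : A.[e] * T ^+ 2 + B.[e] * T + C.[e] = 0 -> p0.[e] + p1.[e] * T = 0.
    by move=> qT; rewrite -hp // pU ?mulr0 //; apply: UP; rewrite ?hA ?hB ?hC ?hb.
  set r' := - B.[e] / A.[e] - r.
  have hr' : A.[e] * r' ^+ 2 + B.[e] * r' + C.[e] = 0.
    by rewrite -hr /r'; field.
  have sum_r : A.[e] * (r + r') = - B.[e] by rewrite /r'; field.
  have prod_r : A.[e] * (r * r') = C.[e].
    rewrite -[RHS]subr0 -hr /r'; field.
    by rewrite Ae.
  have := rt _ hr; have := rt _ hr'; rewrite -prod_r -[B.[e]]opprK -sum_r => e' er.
  split.
    transitivity (A.[e] * ((p0.[e] + p1.[e] * r) + (p0.[e] + p1.[e] * r'))); first by ring.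
    by rewrite er e'; ring.
  transitivity (A.[e] * (p0.[e] + p1.[e] * r) * (p0.[e] + p1.[e] * r')); first by ring.
  by rewrite er; ring.
have tr0 : 2 *: A * p0 - B * p1 = 0.
  by apply: (poly_dense_eq0 bA0) => e /van[]; rewrite !hornerE.
have nm0 : A * p0 ^+ 2 - B * p0 * p1 + C * p1 ^+ 2 = 0.
  by apply: (poly_dense_eq0 bA0) => e /van[_]; rewrite !hornerE.
have {}tr0 : 2 * A.[0] * p0.[0] - B.[0] * p1.[0] = 0.
  by have /(congr1 (horner^~ 0)) := tr0; rewrite !hornerE.
have {}nm0 : A.[0] * p0.[0] ^+ 2 - B.[0] * p0.[0] * p1.[0] + C.[0] * p1.[0] ^+ 2 = 0.
  by have /(congr1 (horner^~ 0)) := nm0; rewrite !hornerE.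
(* w = p0 + p1 T0 satisfies A w^2 = w (A trace) - (A norm) at e = 0. *)
have w0 : p0.[0] + p1.[0] * T0 = 0.
  apply/eqP; rewrite -sqrf_eq0 -(mulrI_eq0 _ (mulfI A0)); apply/eqP.
  transitivity ((p0.[0] + p1.[0] * T0) * (2 * A.[0] * p0.[0] - B.[0] * p1.[0]) -
    (A.[0] * p0.[0] ^+ 2 - B.[0] * p0.[0] * p1.[0] + C.[0] * p1.[0] ^+ 2) +
    p1.[0] ^+ 2 * (A.[0] * T0 ^+ 2 + B.[0] * T0 + C.[0])); first by ring.
  by rewrite tr0 nm0 eq0; ring.
by apply: (mulfI (expf_neq0 k A0)); rewrite hp // w0 mulr0.
Qed.

Lemma closure_curve (K : numClosedFieldType) n (U : pset K n) (b : K -> K)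
    (v : K -> hvec K n) :
  bipoly (fun e _ => b e) -> (forall i, bipoly (fun e _ => v e i)) ->
  b 1 != 0 -> (forall e, b e != 0 -> U (v e)) -> in_closure U (v 0).
Proof.
move=> bP vP b1 UP.
apply: (@closure_quadratic _ _ _ (fun=> 1) (fun=> 0) (fun=> 0) b
          (fun e _ => v e) 0) => //; try exact: bipoly_cst.
- exact: oner_neq0.
- by ring.
- by move=> e T /UP.
Qed.

(** The line from a at e = 0 to y at e = 1. *)
Definition line (K : fieldType) (a y e : K) := a + e * (y - a).

Lemma line0 (K : fieldType) (a y : K) : line a y 0 = a.
Proof. by rewrite /line; ring. Qed.

Lemma line1 (K : fieldType) (a y : K) : line a y 1 = y.
Proof. by rewrite /line; ring. Qed.

Ltac prove_bipoly := repeat first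
  [ exact: bipoly_cst | exact: bipoly_fst | exact: bipoly_snd
  | apply: bipolyD | apply: bipolyN | apply: bipolyX | apply: bipolyM ].

(** * Coordinates in P_5 and P_4 *)

Local Notation "''o_' k" := (@Ordinal 6 k isT)
  (at level 8, k at level 2, format "''o_' k").
Local Notation "''p_' k" := (@Ordinal 5 k isT)
  (at level 8, k at level 2, format "''p_' k").

Lemma all_o6 (P : 'I_6 -> Prop) :
  P 'o_0 -> P 'o_1 -> P 'o_2 -> P 'o_3 -> P 'o_4 -> P 'o_5 -> forall i, P i.
Proof.
move=> h0 h1 h2 h3 h4 h5 [[|[|[|[|[|[|//]]]]]] hi].
- by have -> : Ordinal hi = 'o_0 by exact: val_inj.
- by have -> : Ordinal hi = 'o_1 by exact: val_inj.
- by have -> : Ordinal hi = 'o_2 by exact: val_inj.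
- by have -> : Ordinal hi = 'o_3 by exact: val_inj.
- by have -> : Ordinal hi = 'o_4 by exact: val_inj.
- by have -> : Ordinal hi = 'o_5 by exact: val_inj.
Qed.

Lemma all_o5 (P : 'I_5 -> Prop) :
  P 'p_0 -> P 'p_1 -> P 'p_2 -> P 'p_3 -> P 'p_4 -> forall i, P i.
Proof.
move=> h0 h1 h2 h3 h4 [[|[|[|[|[|//]]]]] hi].
- by have -> : Ordinal hi = 'p_0 by exact: val_inj.
- by have -> : Ordinal hi = 'p_1 by exact: val_inj.
- by have -> : Ordinal hi = 'p_2 by exact: val_inj.
- by have -> : Ordinal hi = 'p_3 by exact: val_inj.
- by have -> : Ordinal hi = 'p_4 by exact: val_inj.
Qed.

(** * The Barth-Nieto quintic *)

(** The third elementary symmetric function of four variables. *)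
Definition e3 (K : pzRingType) (a b c d : K) :=
  b * c * d + a * c * d + a * b * d + a * b * c.

(** The quintic equation, with the coordinates x1 and x2 singled out. *)
Lemma barth_nietoE (K : fieldType) (x : hvec K 5) :
  barth_nieto x <->
  [/\ exists i, x i != 0,
      x 'o_0 + x 'o_1 + x 'o_2 + x 'o_3 + x 'o_4 + x 'o_5 = 0 &
      x 'o_1 * x 'o_2 * e3 (x 'o_0) (x 'o_3) (x 'o_4) (x 'o_5) +
      (x 'o_1 + x 'o_2) * (x 'o_0 * x 'o_3 * x 'o_4 * x 'o_5) = 0].
Proof.
have l0 : ord0 = 'o_0 by exact: val_inj.
have l1 : lift ord0 ord0 = 'o_1 by exact: val_inj.
have l2 : lift ord0 (lift ord0 ord0) = 'o_2 by exact: val_inj.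
have l3 : lift ord0 (lift ord0 (lift ord0 ord0)) = 'o_3 by exact: val_inj.
have l4 : lift ord0 (lift ord0 (lift ord0 (lift ord0 ord0))) = 'o_4 by exact: val_inj.
have l5 : lift ord0 (lift ord0 (lift ord0 (lift ord0 (lift ord0 ord0)))) = 'o_5 by exact: val_inj.
have s6 (f : 'I_6 -> K) : \sum_i f i = f 'o_0 + f 'o_1 + f 'o_2 + f 'o_3 + f 'o_4 + f 'o_5.
  by rewrite !big_ord_recl big_ord0 l5 l4 l3 l2 l1 l0; ring.
have p6 (f : 'I_6 -> K) : \prod_i f i = f 'o_0 * f 'o_1 * f 'o_2 * f 'o_3 * f 'o_4 * f 'o_5.
  by rewrite !big_ord_recl big_ord0 l5 l4 l3 l2 l1 l0; ring.
rewrite /barth_nieto s6.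
have -> : \sum_(j < 6) \prod_(i < 6 | i != j) x i =
      x 'o_1 * x 'o_2 * e3 (x 'o_0) (x 'o_3) (x 'o_4) (x 'o_5) +
      (x 'o_1 + x 'o_2) * (x 'o_0 * x 'o_3 * x 'o_4 * x 'o_5).
  under eq_bigr => j _ do rewrite big_mkcond p6.
  rewrite s6 /= /e3; ring.
by [].
Qed.

Lemma barth_nieto_perm (K : fieldType) (s : 'S_6) (x : hvec K 5) :
  barth_nieto x -> barth_nieto (x \o s).
Proof.
move=> [[i xi] sx px]; split.
- by exists (s^-1%g i); rewrite /= permKV.
- by rewrite -[RHS]sx [RHS](reindex_inj (@perm_inj _ s)).
rewrite -[RHS]px [RHS](reindex_inj (@perm_inj _ s)); apply: eq_bigr => j _.
rewrite [RHS](reindex_inj (@perm_inj _ s)); apply: eq_bigl => i0.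
by rewrite (inj_eq perm_inj).
Qed.

Definition N_torus (K : fieldType) : pset K 5 :=
  fun x => barth_nieto x /\ forall i, x i != 0.

(** An open subset of N that is stable under permutations of the coordinates.
    The case i = j says that no coordinate vanishes. *)
Definition N_open (K : fieldType) : pset K 5 :=
  fun x => barth_nieto x /\ forall i j, x i + x j != 0.

Lemma N_open_perm (K : fieldType) (s : 'S_6) (x : hvec K 5) :
  N_open x -> N_open (x \o s).
Proof. by move=> [Nx nz]; split; [exact: barth_nieto_perm|move=> i j; exact: nz]. Qed.

Definition vec6 (K : Type) (a b c d e f : K) : hvec K 5 :=
  tnth [tuple a; b; c; d; e; f].

(** With s and p the sum and the product of a, b, c, d, a point
    (a, T, - s - T, b, c, d) lies on N iff T is a root of
    e3 T^2 + e3 s T + s p.  This polynomial in a, b, c, d is nonzero only if,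
    for such T, no two coordinates (equal or not) have sum 0: f x is the value
    of the quadratic at T = - x, and also at the T for which - s - T = - x. *)
Definition base_generic (K : pzRingType) (a b c d : K) :=
  let s := a + b + c + d in let p := a * b * c * d in
  let f x := e3 a b c d * (x ^+ 2 - s * x) + s * p in
  (s * p) * (f a * f b * f c * f d) *
  ((a + b) * (a + c) * (a + d) * (b + c) * (b + d) * (c + d)).

Lemma N_open_vec6 (K : numFieldType) (a b c d T : K) :
  let s := a + b + c + d in
  e3 a b c d * T ^+ 2 + e3 a b c d * s * T + s * (a * b * c * d) = 0 ->
  base_generic a b c d != 0 -> N_open (vec6 a T (- s - T) b c d).
Proof.
move=> s eqT; rewrite /base_generic -/s !mulf_eq0 !negb_or.
have dbl (x : K) : x != 0 -> x + x != 0 by rewrite -mulr2n mulrn_eq0.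
have fne x : e3 a b c d * (x ^+ 2 - s * x) + s * (a * b * c * d) != 0 ->
   x + T != 0 /\ x + (- s - T) != 0.
  move=> fx; split; apply: contraNneq fx => h; apply/eqP; rewrite -[RHS]eqT.
    have -> : x = - T by rewrite -[LHS](addrK T) h add0r.
    by ring.
  have -> : x = s + T by apply/eqP; rewrite -subr_eq0 -h; apply/eqP; ring.
  by ring.
move=> /andP[/andP[/andP[s0 /andP[/andP[/andP[a0 b0] c0] d0]]]].
move=> /andP[/andP[/andP[/fne[aT aT'] /fne[bT bT']] /fne[cT cT']] /fne[dT dT']].
move=> /andP[/andP[/andP[/andP[/andP[ab ac] ad] bc] bd] cd].
have [T0 T'0] : T != 0 /\ - s - T != 0.
  rewrite -[T in T != 0]add0r -[X in _ /\ X != 0]add0r; apply: fne.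
  by rewrite expr0n mulr0 subr0 mulr0 add0r !mulf_neq0.
have TT' : T + (- s - T) != 0 by rewrite addrC addrNK oppr_eq0.
split.
  apply/barth_nietoE; split; first by exists 'o_0.
    by rewrite /vec6 /tnth /= /s; ring.
  by rewrite /vec6 /tnth /= -[RHS]oppr0 -[in RHS]eqT /s; ring.
apply: all_o6; apply: all_o6; rewrite /vec6 /tnth /=.
all: try exact: dbl.
all: by [|rewrite addrC].
Qed.

(** The curve: x0, x3, x4, x5 move on the line to (1, 1, 1, 1) and x1 is a root
    of the quadratic. *)
Lemma N_closure_pair (K : numClosedFieldType) (x : hvec K 5) :
  barth_nieto x -> e3 (x 'o_0) (x 'o_3) (x 'o_4) (x 'o_5) != 0 ->
  in_closure (@N_open K) x.
Proof.
move=> /barth_nietoE[_ sx px] e30.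
pose a e := line (x 'o_0) 1 e. pose b e := line (x 'o_3) 1 e.
pose c e := line (x 'o_4) 1 e. pose d e := line (x 'o_5) 1 e.
pose s e := a e + b e + c e + d e.
pose v e T := vec6 (a e) T (- s e - T) (b e) (c e) (d e).
have [[a0 b0] [c0 d0]] : (a 0 = x 'o_0 /\ b 0 = x 'o_3) /\
    (c 0 = x 'o_4 /\ d 0 = x 'o_5) by rewrite /a /b /c /d !line0.
have x2 : x 'o_2 = - s 0 - x 'o_1.
  apply/eqP; rewrite -subr_eq0 -[X in _ == X]sx /s a0 b0 c0 d0; apply/eqP; ring.
apply: (@closure_eq _ _ _ (v 0 (x 'o_1))).
  by apply: all_o6; rewrite /v /vec6 /tnth /= ?x2 ?a0 ?b0 ?c0 ?d0.
apply: (@closure_quadratic _ _ _ (fun e => e3 (a e) (b e) (c e) (d e))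
  (fun e => e3 (a e) (b e) (c e) (d e) * s e)
  (fun e => s e * (a e * b e * c e * d e))
  (fun e => base_generic (a e) (b e) (c e) (d e))).
- rewrite /e3 /a /b /c /d /line; prove_bipoly.
- rewrite /e3 /s /a /b /c /d /line; prove_bipoly.
- rewrite /e3 /s /a /b /c /d /line; prove_bipoly.
- rewrite /base_generic /e3 /s /a /b /c /d /line; prove_bipoly.
- by apply: all_o6; rewrite /v /vec6 /tnth /= /s /a /b /c /d /line; prove_bipoly.
- by rewrite a0 b0 c0 d0.
- rewrite /a /b /c /d !line1 (_ : base_generic _ _ _ _ = 2 ^+ 20) ?expf_neq0 ?pnatr_eq0 //.
  by rewrite /base_generic /e3; ring.
- by rewrite -[RHS]oppr0 -[in RHS]px x2 /s a0 b0 c0 d0; ring.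
- by move=> e T ge eqT; exact: N_open_vec6.
Qed.

(** Without zero coordinates, e3 of four of them vanishes only if the other two
    have sum 0, which cannot happen for all three pairs among x0, x1, x2. *)
Lemma N_torus_closure (K : numClosedFieldType) (x : hvec K 5) :
  N_torus x -> in_closure (@N_open K) x.
Proof.
move=> [Nx nz].
have main (s : 'S_6) : x (s 'o_1) + x (s 'o_2) != 0 -> in_closure (@N_open K) x.
  move=> s12; have Ny := barth_nieto_perm s Nx.
  have [_ _ /= e5] := (barth_nietoE _).1 Ny.
  apply: (@closure_eq _ _ _ ((x \o s) \o (s^-1)%g)) => [i|]; first by rewrite /= permKV.
  apply: closure_perm => [u|]; first exact: N_open_perm.
  apply: N_closure_pair => //=; apply: contraNneq s12 => e30.
  move/eqP: e5; rewrite e30 mulr0 add0r mulf_eq0 => /orP[//|].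
  by rewrite !mulf_eq0 !(negbTE (nz _)).
have [h12|/main] := eqVneq (x ((1%g : 'S_6) 'o_1) + x ((1%g : 'S_6) 'o_2)) 0; last exact.
have [h01|/main] := eqVneq (x ((tperm 'o_0 'o_2) 'o_1) + x ((tperm 'o_0 'o_2) 'o_2)) 0; last exact.
have [h02|/main] := eqVneq (x ((tperm 'o_0 'o_1) 'o_1) + x ((tperm 'o_0 'o_1) 'o_2)) 0; last exact.
move: h12 h01 h02; rewrite !perm1 !tpermR !tpermD // => h12 h01 h02.
have /eqP : x 'o_0 *+ 2 = 0.
  transitivity (x 'o_1 + x 'o_0 + (x 'o_0 + x 'o_2) - (x 'o_1 + x 'o_2)); first by ring.
  by rewrite h12 h01 h02; ring.
by rewrite mulrn_eq0 (negbTE (nz _)).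
Qed.

Lemma sort_zeros (K : fieldType) (x : hvec K 5) : exists s : 'S_6,
  forall i j : 'I_6, (i <= j)%N -> x (s j) = 0 -> x (s i) = 0.
Proof.
pose r (i j : 'I_6) := (x j == 0) ==> (x i == 0).
have rtot : total r by move=> i j; rewrite /r; case: (x i == 0); case: (x j == 0).
have rtr : transitive r.
  by move=> j i k; rewrite /r; case: (x i == 0); case: (x j == 0); case: (x k == 0).
have /tuple_permP[s hs] : perm_eq (sort_tuple r (ord_tuple 6)) (ord_tuple 6) by rewrite perm_sort.
exists s => i j ij xj; apply/eqP.
have nthE (k : 'I_6) : nth 'o_0 (sort r (ord_tuple 6)) k = s k.
  have -> : sort r (ord_tuple 6) = [tuple tnth (ord_tuple 6) (s i) | i < 6].
    by rewrite -hs.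
  by rewrite -tnth_nth tnth_mktuple tnth_ord_tuple.
have sz (k : 'I_6) : (k < size (sort r (ord_tuple 6)))%N by rewrite size_sort size_tuple.
have rr : reflexive r by move=> k; rewrite /r implybb.
have := sorted_leq_nth rtr rr 'o_0 (sort_sorted rtot (ord_tuple 6)) i j (sz i) (sz j) ij.
by rewrite !nthE /r xj eqxx.
Qed.

(** Once the zero coordinates come first, the pair (x1, x2) serves if x0 = 0 and
    x3 <> 0. *)
Lemma N_open_dense (K : numClosedFieldType) (x : hvec K 5) :
  barth_nieto x -> in_closure (@N_open K) x.
Proof.
have [s hs] := sort_zeros x => /(barth_nieto_perm s) Ny.
apply: (@closure_eq _ _ _ ((x \o s) \o (s^-1)%g)) => [i|]; first by rewrite /= permKV.
apply: closure_perm => [u|]; first exact: N_open_perm.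
have {}hs (i j : 'I_6) : (i <= j)%N -> (x \o s) j = 0 -> (x \o s) i = 0 by exact: hs.
move: (x \o s) Ny hs => {}x Nx hs.
have [[i xi] sx px] := (barth_nietoE _).1 Nx.
have nz_after (k j : 'I_6) : x k != 0 -> (k <= j)%N -> x j != 0.
  by move=> xk ij; apply: contra_neq xk; exact: hs.
have [x0|x0] := eqVneq (x 'o_0) 0; last first.
  by apply: N_torus_closure; split=> // j; exact: nz_after x0 _.
(* Here e3 of x0 = 0, x3, x4, x5 is x3 x4 x5. *)
have [x3|x3] := eqVneq (x 'o_3) 0; last first.
  apply: N_closure_pair => //; rewrite /e3 x0 !mul0r !addr0.
  by rewrite !mulf_neq0 //; apply: nz_after x3 _.
have x2 : x 'o_2 = 0 by apply: hs x3.
have x1 : x 'o_1 = 0 by apply: hs x3.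
have x5 : x 'o_5 = - x 'o_4.
  by apply/eqP; rewrite -addr_eq0 addrC -sx x0 x1 x2 x3 !add0r.
have x4 : x 'o_4 != 0.
  apply: contraNneq xi => x4; apply/eqP; move: i.
  by apply: all_o6 => //; rewrite x5 x4 oppr0.
apply: (closure_trans (@N_torus_closure K)).
pose v (e : K) := vec6 e (- e) (2 * e) (- (2 * e)) (x 'o_4) (- x 'o_4).
apply: (@closure_eq _ _ _ (v 0)).
  by apply: all_o6; rewrite /v /vec6 /tnth /= ?mulr0 ?oppr0.
apply: (@closure_curve _ _ _ id).
- exact: bipoly_fst.
- by apply: all_o6; rewrite /v /vec6 /tnth /=; prove_bipoly.
- exact: oner_neq0.
move=> e e0; split.
  apply/barth_nietoE; rewrite /v /vec6 /tnth /=; split; first by exists 'o_4.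
    by ring.
  by rewrite /e3; ring.
have e20 : 2 * e != 0 by rewrite mulf_neq0 ?pnatr_eq0.
by apply: all_o6; rewrite /v /vec6 /tnth /= ?oppr_eq0.
Qed.

(** * The threefold V *)

(** The point (1 : x : y : z : t), with the homogeneous coordinates scaled by c. *)
Definition pt (K : fieldType) (c x y z t : K) : hvec K 4 :=
  fun i => c * tnth [tuple 1; x; y; z; t] i.

Definition V_torus (K : fieldType) : pset K 4 := fun v =>
  exists c x y z t,
    [/\ c != 0, V_affine x y z t, x * y * z != 0 & v =1 pt c x y z t].

Definition V_open (K : fieldType) : pset K 4 := fun v =>
  exists c x y z t,
    [/\ c != 0, V_affine x y z t, x * y * z * (t + 1) != 0 & v =1 pt c x y z t].

(** The curve: x, y, z move on the line to (1, 1, 1) and t is a root of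
    P t^2 + (2 P - Q) t + P = 0, where P = x y z and Q is the left hand side of
    the equation of V; t = -1 is a root only where Q = 0. *)
Lemma V_torus_closure (K : numClosedFieldType) (v : hvec K 4) :
  V_torus v -> in_closure (@V_open K) v.
Proof.
move=> [c [x [y [z [t [c0 [t0 eqV] xyz0 vE]]]]]].
pose X := line x 1; pose Y := line y 1; pose Z := line z 1.
have [[X0 Y0] Z0] : (X 0 = x /\ Y 0 = y) /\ Z 0 = z by rewrite /X /Y /Z !line0.
pose P e := X e * Y e * Z e.
pose Q e := (1 + X e + X e * Y e + P e) * (1 + Z e + Y e * Z e + P e).
apply: (@closure_eq _ _ _ (pt c (X 0) (Y 0) (Z 0) t)) => [i|].
  by rewrite vE X0 Y0 Z0.
apply: (@closure_quadratic _ _ _ P (fun e => 2 * P e - Q e) P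
  (fun e => P e * Q e) (fun e T => pt c (X e) (Y e) (Z e) T)).
- rewrite /P /X /Y /Z /line; prove_bipoly.
- rewrite /Q /P /X /Y /Z /line; prove_bipoly.
- rewrite /P /X /Y /Z /line; prove_bipoly.
- rewrite /Q /P /X /Y /Z /line; prove_bipoly.
- by apply: all_o5; rewrite /pt /tnth /= /X /Y /Z /line; prove_bipoly.
- by rewrite /P X0 Y0 Z0.
- rewrite (_ : P 1 * Q 1 = 2 ^+ 4) ?expf_neq0 ?pnatr_eq0 //.
  by rewrite /Q /P /X /Y /Z !line1; ring.
- rewrite /Q /P X0 Y0 Z0 eqV; field.
  by rewrite t0.
move=> e T; rewrite mulf_eq0 negb_or => /andP[Pe Qe] eqT.
have T0 : T != 0.
  by apply: contraNneq Pe => T0; rewrite -eqT T0; apply/eqP; ring.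
have T1 : T + 1 != 0.
  apply: contraNneq Qe => T1; rewrite -eqT (_ : T = -1); first by apply/eqP; ring.
  by apply/eqP; rewrite -addr_eq0 T1.
exists c, (X e), (Y e), (Z e), T; split=> //; last by rewrite mulf_neq0.
split=> //; apply: (mulIf T0); rewrite -/(P e) -/(Q e).
transitivity ((T + 1) ^+ 2 * P e); last by field.
by rewrite -[RHS]subr0 -[in RHS]eqT; ring.
Qed.

(** The curve: t is fixed, y and z move on the line to (1, 1), and w = 1/x is a
    root of the equation of V multiplied by w^2, whose leading coefficient is
    1 + z + y z.  In homogeneous coordinates the point is
    (w : 1 : y w : z w : t w), which is polynomial in w. *)
Lemma V_closure_x (K : numClosedFieldType) (c x y z t : K) :
  c != 0 -> V_affine x y z t -> x != 0 -> 1 + z + y * z != 0 ->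
  in_closure (@V_torus K) (pt c x y z t).
Proof.
move=> c0 [t0 eqV] x0 g0.
pose Y := line y 1; pose Z := line z 1.
have [Y0 Z0] : Y 0 = y /\ Z 0 = z by rewrite /Y /Z !line0.
pose C := (t + 1) ^+ 2 / t.
pose Q e := Y e * Z e; pose P e := 1 + Y e + Q e; pose g e := 1 + Z e + Q e.
pose u (e w : K) : hvec K 4 :=
  fun i => c * x * tnth [tuple w; 1; Y e * w; Z e * w; t * w] i.
apply: (@closure_eq _ _ _ (u 0 x^-1)).
  by apply: all_o5; rewrite /u /pt /tnth /= ?Y0 ?Z0; field.
apply: (@closure_quadratic _ _ _ g (fun e => Q e + P e * g e - C * Q e)
   (fun e => P e * Q e) (fun e => P e * Q e)).
- rewrite /g /Q /Y /Z /line; prove_bipoly.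
- rewrite /g /P /Q /Y /Z /line; prove_bipoly.
- rewrite /g /P /Q /Y /Z /line; prove_bipoly.
- rewrite /g /P /Q /Y /Z /line; prove_bipoly.
- by apply: all_o5; rewrite /u /tnth /= /Y /Z /line; prove_bipoly.
- by rewrite /g /Q Y0 Z0.
- by rewrite /P /Q /Y /Z !line1 (_ : _ * _ = 3%:R) ?pnatr_eq0 //; ring.
- rewrite /g /P /Q Y0 Z0; apply: (mulfI (expf_neq0 2 x0)); rewrite mulr0.
  transitivity ((1 + x + x * y + x * y * z) * (1 + z + y * z + x * y * z) - C * (x * y * z)).
    by field.
  by rewrite eqV subrr.
move=> e w; rewrite mulf_eq0 negb_or => /andP[Pe Qe] eqw.
have w0 : w != 0.
  apply/eqP => w0; move/eqP: eqw.
  by rewrite w0 expr0n !mulr0 !add0r mulf_eq0 (negbTE Pe) (negbTE Qe).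
exists (c * x * w), w^-1, (Y e), (Z e), t; split.
- by rewrite !mulf_neq0.
- split=> //; apply: (mulfI (expf_neq0 2 w0)); rewrite -/C.
  apply/eqP; rewrite -subr_eq0 -[X in _ == X]eqw /P /g /Q; apply/eqP; field.
  by rewrite w0.
- by rewrite -mulrA mulf_neq0 ?invr_neq0.
by apply: all_o5; rewrite /u /pt /tnth /=; field.
Qed.

Lemma V_affineC (K : fieldType) (x y z t : K) : V_affine x y z t -> V_affine z y x t.
Proof.
move=> [t0 e]; split=> //; rewrite (_ : z * y * x = x * y * z); last by ring.
by rewrite -e; ring.
Qed.

Local Notation swap := (tperm 'p_1 'p_3).

Lemma pt_swap (K : fieldType) (c x y z t : K) : pt c x y z t \o swap =1 pt c z y x t.
Proof.
by apply: all_o5; rewrite /pt /= ?tpermL ?tpermR ?tpermD.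
Qed.

Lemma V_closure_z (K : numClosedFieldType) (c x y z t : K) :
  c != 0 -> V_affine x y z t -> z != 0 -> 1 + x + x * y != 0 ->
  in_closure (@V_torus K) (pt c x y z t).
Proof.
move=> c0 Va z0 g0; apply: (closure_eq (pt_swap c z y x t)).
apply: closure_perm => [u [c' [x' [y' [z' [t' [c'0 Va' nz uE]]]]]]|].
  exists c', z', y', x', t'; split=> //; first exact: V_affineC.
    by rewrite (_ : z' * y' * x' = x' * y' * z') //; ring.
  by move=> i; rewrite /= uE -[RHS]pt_swap.
by apply: V_closure_x => //; [exact: V_affineC | rewrite (mulrC y)].
Qed.

(** For t = -1 the threefold V contains the line (-1, y, -1, -1).  For t <> -1,
    let C = (t + 1)^2 / t, x = z = - (1 + e) and y = e^2 / w.  Then the equation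
    of V, divided by e^2 and multiplied by w^2, becomes
    w^2 + (2 x e^2 - C x^2) w + x^2 e^4 = 0, with root w = C <> 0 at e = 0. *)
Lemma V_closure_y0 (K : numClosedFieldType) (c t : K) :
  c != 0 -> t != 0 -> in_closure (@V_torus K) (pt c (- 1) 0 (- 1) t).
Proof.
move=> c0 t0; have [t1|t1] := eqVneq t (- 1).
  have N1 : - 1 != 0 :> K by rewrite oppr_eq0 oner_neq0.
  pose v (e : K) := pt c (- 1) e (- 1) (- 1).
  rewrite t1; change (in_closure (@V_torus K) (v 0)).
  apply: (@closure_curve _ _ _ id).
  - exact: bipoly_fst.
  - by apply: all_o5; rewrite /v /pt /tnth /=; prove_bipoly.
  - exact: oner_neq0.
  move=> e e0; exists c, (- 1), e, (- 1), (- 1).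
  by split; rewrite ?mulf_neq0 //; split=> //; field.
pose C := (t + 1) ^+ 2 / t.
have C0 : C != 0 by rewrite mulf_neq0 ?invr_neq0 // expf_neq0 // addr_eq0.
pose X (e : K) := - (1 + e).
pose u (e w : K) : hvec K 4 :=
  fun i => (c / C) * tnth [tuple w; X e * w; e ^+ 2; X e * w; t * w] i.
apply: (@closure_eq _ _ _ (u 0 C)).
  by apply: all_o5; rewrite /u /pt /tnth /= /X; field.
apply: (@closure_quadratic _ _ _ (fun=> 1)
  (fun e => 2 * X e * e ^+ 2 - C * X e ^+ 2) (fun e => X e ^+ 2 * e ^+ 4)
  (fun e => X e * e) u).
- exact: bipoly_cst.
- rewrite /X; prove_bipoly.
- rewrite /X; prove_bipoly.
- rewrite /X; prove_bipoly.
- by apply: all_o5; rewrite /u /tnth /= /X; prove_bipoly.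
- exact: oner_neq0.
- by rewrite /X mulr1 oppr_eq0 -[1 + 1]/(2%:R) pnatr_eq0.
- by rewrite /X; ring.
move=> e w; rewrite mulf_eq0 negb_or => /andP[Xe e0] eqw.
have w0 : w != 0.
  apply/eqP => w0; move/eqP: eqw; rewrite w0 expr0n !mulr0 !add0r mulf_eq0.
  by rewrite !expf_eq0 /= (negbTE Xe) (negbTE e0).
exists (c / C * w), (X e), (e ^+ 2 / w), (X e), t; split.
- by rewrite !mulf_neq0 ?invr_neq0.
- split=> //; rewrite -/C; apply: (mulfI (expf_neq0 2 w0)).
  apply: (mulfI (expf_neq0 2 e0)); apply/eqP; rewrite -subr_eq0.
  apply/eqP; transitivity (e ^+ 4 * (1 * w ^+ 2 +
    (2 * X e * e ^+ 2 - C * X e ^+ 2) * w + X e ^+ 2 * e ^+ 4)).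
    by rewrite /X; field.
  by rewrite eqw mulr0.
- by rewrite !mulf_neq0 ?invr_neq0.
by apply: all_o5; rewrite /u /pt /tnth /=; field; rewrite ?w0.
Qed.

Lemma V_open_dense (K : numClosedFieldType) (v : hvec K 4) :
  V_threefold v -> in_closure (@V_open K) v.
Proof.
move=> [x [y [z [t [Va [c c0 vE]]]]]]; apply: (closure_trans (@V_torus_closure K)).
apply: (@closure_eq _ _ _ (pt c x y z t)) => [i|]; first by rewrite vE.
have [nz|] := eqVneq (x * y * z) 0; last first.
  by move=> nz; apply: closure_self; exists c, x, y, z, t.
have [t0 /eqP] := Va; rewrite nz mulr0 mulf_eq0.
have [x0|x0] := eqVneq x 0.
  rewrite x0 !(mul0r, addr0) oner_eq0 /= => eqV.
  rewrite -x0; apply: V_closure_z => //; last by rewrite x0 !(mul0r, addr0) oner_eq0.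
  by apply: contraTneq eqV => ->; rewrite !(mulr0, addr0) oner_eq0.
have [z0|z0] := eqVneq z 0.
  by move=> _; apply: V_closure_x; rewrite // z0 !(mulr0, addr0) oner_eq0.
have y0 : y = 0.
  by apply/eqP; move/eqP: nz; rewrite !mulf_eq0 (negbTE x0) (negbTE z0) orbF.
have [x1|x1] := eqVneq (1 + x) 0; last first.
  by move=> _; apply: V_closure_z; rewrite // y0 mulr0 addr0.
have [z1|z1] := eqVneq (1 + z) 0; last first.
  by move=> _; apply: V_closure_x; rewrite // y0 mul0r addr0.
move=> _; have -> : x = -1 by apply/eqP; rewrite -addr_eq0 addrC x1.
have -> : z = -1 by apply/eqP; rewrite -addr_eq0 addrC z1.
by rewrite y0; apply: V_closure_y0.
Qed.

(** * The two rational maps *)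

Lemma dhomogXU (R : nzRingType) n (i : 'I_n) : ('X_i : {mpoly R[n]}) \is 1.-homog.
Proof. by rewrite dhomogX; apply/eqP; exact: mdeg1. Qed.

Ltac prove_homog := solve
  [ exact: dhomogXU | apply: dhomogD; prove_homog
  | rewrite dhomogN; prove_homog
  | apply: (@dhomogM _ _ _ 3 _ 1); prove_homog
  | apply: (@dhomogM _ _ _ 2 _ 1); prove_homog
  | apply: (@dhomogM _ _ _ 1 _ 1); prove_homog
  | apply: (@dhomogM _ _ _ 1 _ 2); prove_homog
  | apply: (@dhomogM _ _ _ 1 _ 3); prove_homog ].

(** (1 : x1/x0 : x2/x1 : x3/x2 : x4/x5), multiplied by x0 x1 x2 x5. *)
Definition N_to_V_forms : 5.-tuple {mpoly rat[6]} :=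
  [tuple 'X_('o_0) * 'X_('o_1) * 'X_('o_2) * 'X_('o_5);
         'X_('o_1) * 'X_('o_1) * 'X_('o_2) * 'X_('o_5);
         'X_('o_0) * 'X_('o_2) * 'X_('o_2) * 'X_('o_5);
         'X_('o_0) * 'X_('o_1) * 'X_('o_3) * 'X_('o_5);
         'X_('o_0) * 'X_('o_1) * 'X_('o_2) * 'X_('o_4)].

Lemma N_to_V_homog j : tnth N_to_V_forms j \is 4.-homog.
Proof. by move: j; apply: all_o5; rewrite /N_to_V_forms /tnth /=; prove_homog. Qed.

(** 1 + x + x y + x y z, made homogeneous of degree 3. *)
Definition partial_sum : {mpoly rat[5]} :=
  'X_('p_0) * 'X_('p_0) * 'X_('p_0) + 'X_('p_1) * 'X_('p_0) * 'X_('p_0) +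
  'X_('p_1) * 'X_('p_2) * 'X_('p_0) + 'X_('p_1) * 'X_('p_2) * 'X_('p_3).

(** With s = 1 + x + x y + x y z, the point
    (1 : x : x y : x y z : - s t/(t+1) : - s/(t+1)), multiplied by t + 1 and
    made homogeneous of degree 4. *)
Definition V_to_N_forms : 6.-tuple {mpoly rat[5]} :=
  [tuple ('X_('p_0) + 'X_('p_4)) * ('X_('p_0) * 'X_('p_0) * 'X_('p_0));
         ('X_('p_0) + 'X_('p_4)) * ('X_('p_1) * 'X_('p_0) * 'X_('p_0));
         ('X_('p_0) + 'X_('p_4)) * ('X_('p_1) * 'X_('p_2) * 'X_('p_0));
         ('X_('p_0) + 'X_('p_4)) * ('X_('p_1) * 'X_('p_2) * 'X_('p_3));
         - (partial_sum * 'X_('p_4)); - (partial_sum * 'X_('p_0))].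

Lemma V_to_N_homog j : tnth V_to_N_forms j \is 4.-homog.
Proof.
by move: j; apply: all_o6; rewrite /V_to_N_forms /partial_sum /tnth /=; prove_homog.
Qed.

Definition N_to_V := FormsOverQ N_to_V_homog.
Definition V_to_N := FormsOverQ V_to_N_homog.

Lemma N_to_V_eval (K : numFieldType) (v : hvec K 5) :
  eval_forms N_to_V v =1 tnth [tuple v 'o_0 * v 'o_1 * v 'o_2 * v 'o_5;
    v 'o_1 * v 'o_1 * v 'o_2 * v 'o_5; v 'o_0 * v 'o_2 * v 'o_2 * v 'o_5;
    v 'o_0 * v 'o_1 * v 'o_3 * v 'o_5; v 'o_0 * v 'o_1 * v 'o_2 * v 'o_4].
Proof.
by apply: all_o5; rewrite /eval_forms /= /N_to_V_forms /tnth /= !rmorphM /= !map_mpolyX !mevalXU.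
Qed.

Lemma V_to_N_eval (K : numFieldType) (w : hvec K 4) :
  let S := w 'p_0 ^+ 3 + w 'p_1 * w 'p_0 ^+ 2 + w 'p_1 * w 'p_2 * w 'p_0 +
     w 'p_1 * w 'p_2 * w 'p_3 in
  eval_forms V_to_N w =1 tnth [tuple (w 'p_0 + w 'p_4) * w 'p_0 ^+ 3;
    (w 'p_0 + w 'p_4) * (w 'p_1 * w 'p_0 ^+ 2);
    (w 'p_0 + w 'p_4) * (w 'p_1 * w 'p_2 * w 'p_0);
    (w 'p_0 + w 'p_4) * (w 'p_1 * w 'p_2 * w 'p_3);
    - (S * w 'p_4); - (S * w 'p_0)].
Proof.
move=> S; apply: all_o6; rewrite /eval_forms /= /V_to_N_forms /tnth /= /partial_sum.
all: rewrite ?(rmorphM, rmorphD, rmorphN) /= ?map_mpolyX !(mevalD, mevalN, mevalM, mevalXU).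
all: by rewrite /S; ring.
Qed.

Lemma N_to_V_in_V (K : numClosedFieldType) (v : hvec K 5) :
  barth_nieto v -> (forall i, v i != 0) -> v 'o_4 + v 'o_5 != 0 ->
  V_threefold (eval_forms N_to_V v).
Proof.
move=> /barth_nietoE[_ sv ev] nz t1.
have [[[n0 n1] n2] [n4 n5]] :=
  ((nz 'o_0, nz 'o_1, nz 'o_2), (nz 'o_4, nz 'o_5)).
exists (v 'o_1 / v 'o_0), (v 'o_2 / v 'o_1), (v 'o_3 / v 'o_2), (v 'o_4 / v 'o_5).
split; last first.
  exists (v 'o_0 * v 'o_1 * v 'o_2 * v 'o_5); first by rewrite !mulf_neq0.
  by apply: all_o5; rewrite N_to_V_eval /tnth /=; field; rewrite ?n0 ?n1 ?n5.
split; first by rewrite mulf_neq0 ?invr_neq0.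
move: sv ev nz n0 n1 n2 n4 n5 t1; rewrite /e3.
move: (v 'o_0) (v 'o_1) (v 'o_2) (v 'o_3) (v 'o_4) (v 'o_5) => a b c d e f.
move=> sv ev _ a0 b0 c0 e0 f0 ef.
(* The equation of V, cleared of denominators. *)
have D0 : a ^+ 2 * b * c * e * f != 0 by rewrite !mulf_neq0 ?expf_neq0.
apply: (mulfI D0).
transitivity ((a + b + c + d) * ((a * b * c + a * b * d + a * c * d + b * c * d) * (e * f))).
  by field; rewrite ?a0 ?b0 ?c0.
transitivity ((e + f) ^+ 2 * (a * b * c * d)); last by field; rewrite ?a0 ?b0 ?c0 ?e0 ?f0.
have -> : (a * b * c + a * b * d + a * c * d + b * c * d) * (e * f) = - (a * b * c * d * (e + f)).
  apply/eqP; rewrite -subr_eq0 -[X in _ == X]ev; apply/eqP; ring.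
have -> : a + b + c + d = - (e + f).
  by apply/eqP; rewrite -subr_eq0 -[X in _ == X]sv; apply/eqP; ring.
by ring.
Qed.

Lemma V_threefoldP (K : fieldType) (w : hvec K 4) : V_threefold w ->
  exists c x y z t, [/\ c != 0, V_affine x y z t &
    [/\ w 'p_0 = c, w 'p_1 = c * x, w 'p_2 = c * y, w 'p_3 = c * z & w 'p_4 = c * t]].
Proof.
move=> [x [y [z [t [Va [c c0 wE]]]]]]; exists c, x, y, z, t; split=> //.
by rewrite !wE /tnth /= mulr1.
Qed.

Lemma V_to_N_in_N (K : numClosedFieldType) (w : hvec K 4) :
  V_threefold w ->
  (w 'p_0 + w 'p_4) * (w 'p_1 * w 'p_2 * w 'p_3) != 0 ->
  barth_nieto (eval_forms V_to_N w).
Proof.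
move=> /V_threefoldP[c [x [y [z [t [c0 [t0 eqV] [w0 w1 w2 w3 w4]]]]]]] nz.
apply/barth_nietoE; split.
- by exists 'o_3; rewrite V_to_N_eval.
- by rewrite !V_to_N_eval /tnth /=; ring.
have {}eqV : (1 + x + x * y + x * y * z) * (1 + z + y * z + x * y * z) * t
    - (t + 1) ^+ 2 * (x * y * z) = 0.
  by rewrite eqV; field.
rewrite !V_to_N_eval /tnth /= w0 w1 w2 w3 w4 /e3.
(* The quintic at the image is this multiple of the equation of V. *)
rewrite -[RHS](mulr0 (c ^+ 20 * (t + 1) ^+ 3 * x ^+ 2 * y * (1 + x + x * y + x * y * z))).
by rewrite -[in RHS]eqV; ring.
Qed.

Lemma N_to_VK (K : numClosedFieldType) (v : hvec K 5) :
  barth_nieto v -> (forall i, v i != 0) -> v 'o_4 + v 'o_5 != 0 ->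
  same_point v (eval_forms V_to_N (eval_forms N_to_V v)).
Proof.
move=> /barth_nietoE[_ sv _] nz t1.
exists (v 'o_0 ^+ 3 * v 'o_1 ^+ 4 * v 'o_2 ^+ 4 * v 'o_5 ^+ 3 * (v 'o_4 + v 'o_5)).
  by rewrite !mulf_neq0 ?expf_neq0.
have v3 : v 'o_3 = - (v 'o_0 + v 'o_1 + v 'o_2 + v 'o_4 + v 'o_5).
  by apply/eqP; rewrite -addr_eq0 -[X in _ == X]sv; apply/eqP; ring.
by apply: all_o6; rewrite V_to_N_eval !N_to_V_eval /tnth /= ?v3; ring.
Qed.

Lemma V_to_NK (K : numClosedFieldType) (w : hvec K 4) :
  V_threefold w ->
  (w 'p_0 + w 'p_4) * (w 'p_1 * w 'p_2 * w 'p_3) != 0 ->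
  same_point w (eval_forms N_to_V (eval_forms V_to_N w)).
Proof.
move=> /V_threefoldP[c [x [y [z [t [c0 [t0 eqV] [w0 w1 w2 w3 w4]]]]]]] nz.
rewrite w0 w1 w2 w3 w4 in nz.
pose A := 1 + x + x * y + x * y * z.
have {nz} [t1 x0 y0 z0] : [/\ t + 1 != 0, x != 0, y != 0 & z != 0].
  by split; apply: contraNneq nz => h; apply/eqP;
    [transitivity (c ^+ 4 * (t + 1) * x * y * z); first ring | ..];
    rewrite h ?(mulr0, mul0r).
have A0 : A != 0.
  have R0 : (t + 1) ^+ 2 / t * (x * y * z) != 0.
    by rewrite !mulf_neq0 ?invr_neq0 ?expf_neq0.
  by apply: contraNneq R0 => A0; rewrite -eqV -/A A0 mul0r.
exists (- (c ^+ 15 * (t + 1) ^+ 3 * x ^+ 2 * y * A)).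
  by rewrite oppr_eq0 !mulf_neq0 ?expf_neq0.
by apply: all_o5; rewrite N_to_V_eval !V_to_N_eval /tnth /= w0 w1 w2 w3 w4 /A; ring.
Qed.

(** * The open sets on which the maps are inverse to each other *)

Lemma N_generically (K : numClosedFieldType) (P : pset K 5) :
  (forall v, barth_nieto v -> (forall i, v i != 0) -> v 'o_4 + v 'o_5 != 0 -> P v) ->
  generically (@barth_nieto K) P.
Proof.
move=> NP.
pose p : {mpoly K[6]} := \prod_(i < 6) 'X_i * ('X_('o_4) + 'X_('o_5)).
have pE v : p.@[v] = \prod_i v i * (v 'o_4 + v 'o_5).
  by rewrite mevalM mevalD !mevalXU rmorph_prod;
     congr (_ * _); apply: eq_bigr => i _; rewrite /= mevalXU.
have hp : p \is 7.-homog.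
  apply: (@dhomogM _ _ _ 6 _ 1); last by apply: dhomogD; exact: dhomogXU.
  rewrite !big_ord_recl big_ord0 mulr1.
  apply: (@dhomogM _ _ _ 1 _ 5); first exact: dhomogXU.
  apply: (@dhomogM _ _ _ 1 _ 4); first exact: dhomogXU.
  by apply: (@dhomogM _ _ _ 1 _ 3); prove_homog.
apply: (generically_nonzero hp) => v.
  move=> /N_open_dense; apply: closure_trans => u [Nu nz]; apply: closure_self; split=> //.
  rewrite pE mulf_neq0 //; apply/prodf_neq0 => i _.
  by have := nz i i; apply: contra_neq => ->; rewrite addr0.
move=> Nv; rewrite pE mulf_eq0 negb_or => /andP[/prodf_neq0 nz].
by apply: NP => // i; exact: nz.
Qed.

Lemma V_generically (K : numClosedFieldType) (P : pset K 4) :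
  (forall w, V_threefold w -> (w 'p_0 + w 'p_4) * (w 'p_1 * w 'p_2 * w 'p_3) != 0 -> P w) ->
  generically (@V_threefold K) P.
Proof.
move=> VP.
pose p : {mpoly K[5]} := ('X_('p_0) + 'X_('p_4)) * ('X_('p_1) * 'X_('p_2) * 'X_('p_3)).
have pE v : p.@[v] = (v 'p_0 + v 'p_4) * (v 'p_1 * v 'p_2 * v 'p_3).
  by rewrite !(mevalM, mevalD, mevalXU).
have hp : p \is 4.-homog by rewrite /p; prove_homog.
apply: (generically_nonzero hp) => w; last by rewrite pE; exact: VP.
move=> /V_open_dense; apply: closure_trans => u [c [x [y [z [t [c0 Va nz uE]]]]]].
apply: closure_self; split.
  by exists x, y, z, t; split=> //; exists c.
rewrite pE !uE /pt /tnth /= mulr1.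
rewrite (_ : (c + c * t) * (c * x * (c * y) * (c * z)) =
    c ^+ 4 * (x * y * z * (t + 1))); last by ring.
by rewrite mulf_neq0 ?expf_neq0.
Qed.

Theorem theorem5p3 (K : numClosedFieldType) :
  birational_overQ (@barth_nieto K) (@V_threefold K).
Proof.
exists N_to_V, V_to_N; split.
- exact/N_generically/N_to_V_in_V.
- exact/V_generically/V_to_N_in_N.
- exact/N_generically/N_to_VK.
- exact/V_generically/V_to_NK.
Qed.
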